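(* Let $\Omega$ be a compact metric space and let $K$ be a kernel on $\Omega\times\Omega$. (a) Let $\mu\in\mathbb P(\Omega)$ be a $K$-invariant measure, i.e. $U_K^\mu(x)=I_K(\mu)$ for all $x\in\Omega$. Then for any $\nu\in\widetilde{\mathbb P}(\Omega)$, $$I_K(\nu-\mu)=I_K(\nu)-I_K(\mu).$$ (b) More generally, if $\mu\in\mathbb P(\Omega)$ satisfies $U_K^\mu(x)\ge I_K(\mu)$ for all $x\in\Omega$, with equality on $\operatorname{supp}(\mu)$, then for any $\nu\in\mathbb P(\Omega)$, $$I_K(\nu-\mu)\le I_K(\nu)-I_K(\mu),$$ and the equality $I_K(\nu-\mu)=I_K(\nu)-I_K(\mu)$ holds for any measure $\nu\in\widetilde{\mathbb P}(\Omega)$ with $\operatorname{supp}(\nu)\subseteq\operatorname{supp}(\mu)$.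
   Context: A kernel on $\Omega\times\Omega$ is a continuous symmetric function $K:\Omega\times\Omega\to\mathbb R$. $\mathcal M(\Omega)$ is the set of finite regular signed Borel measures on $\Omega$; $\mathbb P(\Omega)$ the Borel probability measures; $\widetilde{\mathbb P}(\Omega)$ the set of $\nu\in\mathcal M(\Omega)$ with $\nu(\Omega)=1$. For $\gamma\in\mathcal M(\Omega)$, $I_K(\gamma)=\int_\Omega\int_\Omega K(x,y)\,d\gamma(x)\,d\gamma(y)$ and $U_K^\mu(x)=\int_\Omega K(x,y)\,d\mu(y)$. *)

(* Defs.v *)
From HB Require Import structures.
From mathcomp Require Import all_boot all_order all_algebra.
From mathcomp Require Import all_classical all_reals all_analysis.

Set Implicit Arguments.
Unset Strict Implicit.
Unset Printing Implicit Defensive.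

Import Order.TTheory GRing.Theory Num.Theory.
Import numFieldNormedType.Exports.

Local Open Scope classical_set_scope.
Local Open Scope ring_scope.

(* Metric spaces with their Borel sigma-algebra. Measurable types are pointed,
   so the space is nonempty; on an empty space there is no probability. *)
HB.mixin Record isBorel (R : numDomainType) (d : measure_display) T
    & Metric R T & Measurable d T := {
  borel_measurableE : @measurable d T = <<s @open T >>
}.

#[short(type="borelMetricType")]
HB.structure Definition BorelMetric (R : numDomainType) (d : measure_display) :=
  { T of Metric R T & Measurable d T & isBorel R d T }.

Section signed_measures.
Context (R : realType) (d : measure_display) (T : measurableType d).
Implicit Types nu : {charge set T -> \bar R}.

Lemma hahn_pair_ex nu :
  exists PN : set T * set T, hahn_decomposition nu PN.1 PN.2.
Proof. by have [P [N hPN]] := Hahn_decomposition nu; exists (P, N). Qed.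

(* A chosen Hahn decomposition; the Jordan parts do not depend on the choice
   (Hahn_decomposition_uniq). *)
Definition hahnP nu := svalP (cid (hahn_pair_ex nu)).

Definition total_variation nu : set T -> \bar R :=
  charge_variation (hahnP nu).

Definition charge_integral nu (f : T -> R) : R :=
  \int[jordan_pos (hahnP nu)]_x f x - \int[jordan_neg (hahnP nu)]_x f x.

Definition charge_sub nu1 nu2 : {charge set T -> \bar R} :=
  cadd nu1 (copp nu2).

Definition prob_charge (mu : probability T R) : {charge set T -> \bar R} :=
  charge_of_finite_measure mu.

End signed_measures.

Section potential_theory.
Context (R : realType) (d : measure_display) (Omega : borelMetricType R d).
Implicit Types (K : Omega * Omega -> R) (nu : {charge set Omega -> \bar R}).

Definition kernel_on K : Prop :=
  continuous K /\ forall x y, K (x, y) = K (y, x).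

Definition regular_charge nu : Prop :=
  forall A, measurable A -> forall e : R, 0 < e ->
    exists C U, [/\ compact C, open U, C `<=` A, A `<=` U
      & (total_variation nu (U `\` C) < e%:E)%E].

Definition signed_probability nu : Prop :=
  regular_charge nu /\ nu [set: Omega] = 1%E.

Definition charge_supp nu : set Omega :=
  [set x | forall U, open U -> U x -> (0 < total_variation nu U)%E].

Definition potential K nu (x : Omega) : R :=
  charge_integral nu (fun y => K (x, y)).

Definition energy K nu : R :=
  charge_integral nu (fun y => charge_integral nu (fun x => K (x, y))).

Definition K_invariant K nu : Prop :=
  forall x, potential K nu x = energy K nu.

End potential_theory.

(* Main.v *)
Require Import Defs.
From HB Require Import structures.
From mathcomp Require Import all_boot all_order all_algebra.
From mathcomp Require Import all_classical all_reals all_analysis.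
From mathcomp Require Import measurable_realfun lra.

(** Bilinearity of the mutual energy gives, for all signed measures nu and mu,
      I(nu - mu) = I(nu) - I(mu) - 2 (int U^mu dnu - I(mu)),          (energy_sub)
    the two cross terms int U^mu dnu and int U^nu dmu being equal because K is
    symmetric and the order of integration can be exchanged. Every claim is then
    about the sign of int U^mu dnu - I(mu) for nu of total mass 1: this number is
    the integral of U^mu - I(mu) against nu. It is 0 if U^mu is constantly I(mu);
    it is nonnegative if U^mu >= I(mu) and nu is a probability; and it is 0 again
    if U^mu = I(mu) on supp mu and nu lives on supp mu.

    Two kinds of facts stand behind this computation.
    - Integration against a signed measure is defined through a chosen Jordan
      decomposition, so its additivity in the measure is not immediate. It follows
      from charge_integral_diff: any writing of nu as a difference of two finite
      measures computes the same integral. Fubini for signed measures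
      (charge_fubini) reduces in the same way to that for finite measures.
    - A compact metric space is second countable. So an open subset of the square
      is a countable union of open boxes, which makes K measurable for the product
      sigma-algebra (continuous_prod_measurable), as Fubini requires; and the
      complement of the support of nu is a countable union of null open sets,
      hence null (charge_suppC_null). *)

Set Implicit Arguments.
Unset Strict Implicit.
Unset Printing Implicit Defensive.

Import Order.TTheory GRing.Theory Num.Theory.
Import numFieldNormedType.Exports.

Local Open Scope classical_set_scope.
Local Open Scope ring_scope.

(** * Integration against a signed measure *)

Section finite_measure_add.
Context d (T : measurableType d) (R : realType).
Variables m1 m2 : {finite_measure set T -> \bar R}.

Let fin_num_measure_add : fin_num_fun (measure_add m1 m2).
Proof. by move=> A mA; rewrite measure_addE fin_numD !fin_num_measure. Qed.

HB.instance Definition _ := Measure.on (measure_add m1 m2).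

HB.instance Definition _ := @Measure_isFinite.Build _ _ _
  (measure_add m1 m2) fin_num_measure_add.

End finite_measure_add.

Section charge_integral.
Context d (T : measurableType d) (R : realType).
Implicit Types (nu : {charge set T -> \bar R}) (f g : T -> R).

(** Asking integrability of all finite measures at once makes the Jordan parts of
    any charge admissible, and it is what the Fubini theorem yields directly for
    potentials, where boundedness would take a separate estimate. *)
Definition finitely_integrable f :=
  forall m : {finite_measure set T -> \bar R}, m.-integrable setT (EFin \o f).

Lemma bounded_finitely_integrable f :
  measurable_fun setT f -> [bounded f x | x in [set: T]] ->
  finitely_integrable f.
Proof.
move=> mf bf m; apply: measurable_bounded_integrable => //.
by rewrite ltey_eq fin_num_measure.
Qed.

Lemma finitely_integrable_cst c : finitely_integrable (cst c).
Proof. by move=> m; exact: finite_measure_integrable_cst. Qed.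

Lemma finitely_integrableB f g :
  finitely_integrable f -> finitely_integrable g ->
  finitely_integrable (fun x => f x - g x).
Proof.
by move=> intf intg m; exact: (integrableB measurableT (intf m) (intg m)).
Qed.

Lemma finitely_integrable_measurable f :
  finitely_integrable f -> measurable_fun setT f.
Proof.
(* Any finite measure will do to extract measurability from integrability. *)
by move=> intf; apply/measurable_EFinP/(measurable_int (dirac point))/intf.
Qed.

Lemma Rintegral_measure_add (m1 m2 : {finite_measure set T -> \bar R}) f :
  finitely_integrable f ->
  \int[measure_add m1 m2]_x f x = \int[m1]_x f x + \int[m2]_x f x.
Proof.
move=> intf; rewrite /Rintegral integral_measure_add//; last 2 first.
- exact: (intf m1).
- exact: (intf m2).
by rewrite fineD//; apply: integrable_fin_num => //;
  [exact: (intf m1)|exact: (intf m2)].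
Qed.

(** If nu = m1 - m2 then p + m2 = n + m1 for the Jordan parts p and n of nu, and
    an identity between sums of finite measures can be integrated termwise. *)
Lemma charge_integral_diff nu (m1 m2 : {finite_measure set T -> \bar R}) f :
  finitely_integrable f ->
  (forall A, measurable A -> nu A = m1 A - m2 A)%E ->
  charge_integral nu f = \int[m1]_x f x - \int[m2]_x f x.
Proof.
move=> intf nuE; rewrite /charge_integral.
set p := jordan_pos _; set n := jordan_neg _.
have : \int[measure_add p m2]_x f x = \int[measure_add n m1]_x f x.
  congr fine; apply: eq_measure_integral => A mA _.
  rewrite /= !measure_addE; have := nuE A mA.
  rewrite (jordan_decomp (hahnP nu) mA) -/p -/n /cadd/= cscaleN1.
  have : p A \is a fin_num by rewrite fin_num_measure.
  have : n A \is a fin_num by rewrite fin_num_measure.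
  have : m1 A \is a fin_num by rewrite fin_num_measure.
  have : m2 A \is a fin_num by rewrite fin_num_measure.
  rewrite /= -/p -/n.
  move: (p A) (n A) (m1 A) (m2 A) => [a| |] [b| |] [c| |] [e| |]//= _ _ _ _.
  by rewrite -!EFinB -!EFinD => -[h]; congr EFin; lra.
rewrite !Rintegral_measure_add//; lra.
Qed.

Lemma charge_integral_measure (m : {finite_measure set T -> \bar R}) f :
  finitely_integrable f ->
  charge_integral (charge_of_finite_measure m) f = \int[m]_x f x.
Proof.
move=> intf; rewrite (@charge_integral_diff _ m mzero)//.
  by rewrite [X in _ - X]/Rintegral integral_measure_zero subr0.
by move=> A mA; rewrite /= /mzero sube0.
Qed.

Lemma charge_integral_sub nu1 nu2 f : finitely_integrable f ->
  charge_integral (charge_sub nu1 nu2) f =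
  charge_integral nu1 f - charge_integral nu2 f.
Proof.
move=> intf; rewrite (@charge_integral_diff _
  (measure_add (jordan_pos (hahnP nu1)) (jordan_neg (hahnP nu2)))
  (measure_add (jordan_neg (hahnP nu1)) (jordan_pos (hahnP nu2))))//.
  by rewrite !Rintegral_measure_add// /charge_integral; lra.
move=> A mA; rewrite /= !measure_addE /charge_sub /cadd/= /copp.
rewrite (jordan_decomp (hahnP nu1) mA) (jordan_decomp (hahnP nu2) mA).
rewrite /cadd/= !cscaleN1.
set p := jordan_pos (hahnP nu1); set n := jordan_neg (hahnP nu1).
set p' := jordan_pos (hahnP nu2); set n' := jordan_neg (hahnP nu2).
rewrite /= -/p -/n -/p' -/n'.
have : p A \is a fin_num by rewrite fin_num_measure.
have : n A \is a fin_num by rewrite fin_num_measure.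
have : p' A \is a fin_num by rewrite fin_num_measure.
have : n' A \is a fin_num by rewrite fin_num_measure.
move: (p A) (n A) (p' A) (n' A) => [a| |] [b| |] [c| |] [e| |]//= _ _ _ _.
change ((a - b - (c - e))%:E = (a + e - (b + c))%:E); congr EFin; lra.
Qed.

Lemma charge_integralB nu f g :
  finitely_integrable f -> finitely_integrable g ->
  charge_integral nu (fun x => f x - g x) =
  charge_integral nu f - charge_integral nu g.
Proof.
move=> intf intg; rewrite /charge_integral !RintegralB//; first lra.
all: by [exact: intf|exact: intg].
Qed.

Lemma charge_integral_cst nu c :
  charge_integral nu (cst c) = c * fine (nu setT).
Proof.
rewrite /charge_integral !Rintegral_cst// -mulrBr -fineB ?fin_num_measure//.
congr (_ * fine _).
by rewrite (jordan_decomp (hahnP nu) measurableT) /cadd/= cscaleN1.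
Qed.

(** The total variation is the sum of the Jordan parts, so a set that is null for
    it is null for both of them. *)
Lemma eq_charge_integral_null nu A f g : measurable A ->
  Defs.total_variation nu A = 0%E ->
  measurable_fun setT f -> measurable_fun setT g ->
  (forall x, ~ A x -> f x = g x) ->
  charge_integral nu f = charge_integral nu g.
Proof.
move=> mA A0 mf mg fg.
have [pA nA] : jordan_pos (hahnP nu) A = 0%E /\ jordan_neg (hahnP nu) A = 0%E.
  move: A0; rewrite /Defs.total_variation /charge_variation/=.
  by move=> /eqP; rewrite padde_eq0// => /andP[/eqP ? /eqP ?].
rewrite /charge_integral; congr (fine _ - fine _);
  apply: ae_eq_integral => //; try exact/measurable_EFinP;
  exists A; split => // x /= nfg; apply: contrapT => /fg e; apply: nfg => _;
  by rewrite e.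
Qed.

End charge_integral.

(** * Exchanging the order of integration *)

Section fubini.
Context d1 d2 (T1 : measurableType d1) (T2 : measurableType d2) (R : realType).
Variable K : T1 * T2 -> R.
Hypothesis mK : measurable_fun setT K.
Hypothesis bK : [bounded K z | z in [set: T1 * T2]].

Lemma bounded_integrable_prod (m1 : {finite_measure set T1 -> \bar R})
    (m2 : {finite_measure set T2 -> \bar R}) :
  (m1 \x m2)%E.-integrable setT (EFin \o K).
Proof.
apply: measurable_bounded_integrable => //.
rewrite -setXTT [ltLHS]product_measure1E// ltey_eq.
by rewrite fin_numM ?fin_num_measure.
Qed.

Lemma section1_finitely_integrable x :
  finitely_integrable (fun y => K (x, y)).
Proof.
apply: bounded_finitely_integrable; first exact: measurable_fun_pair2.
by have [M [Mreal KM]] := bK; exists M; split => // N MN y _; exact: KM.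
Qed.

Lemma section2_finitely_integrable y :
  finitely_integrable (fun x => K (x, y)).
Proof.
apply: bounded_finitely_integrable; first exact: measurable_fun_pair1.
by have [M [Mreal KM]] := bK; exists M; split => // N MN x _; exact: KM.
Qed.

Lemma EFin_Rintegral_section1 (m : {finite_measure set T2 -> \bar R}) :
  EFin \o (fun x => \int[m]_y K (x, y)) = fubini_F m (EFin \o K).
Proof.
apply/funext => x /=; rewrite /Rintegral fineK//.
by apply: integrable_fin_num => //; exact: section1_finitely_integrable.
Qed.

Lemma EFin_Rintegral_section2 (m : {finite_measure set T1 -> \bar R}) :
  EFin \o (fun y => \int[m]_x K (x, y)) = fubini_G m (EFin \o K).
Proof.
apply/funext => y /=; rewrite /Rintegral fineK//.
by apply: integrable_fin_num => //; exact: section2_finitely_integrable.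
Qed.

Lemma finitely_integrable_Rintegral1 (m : {finite_measure set T2 -> \bar R}) :
  finitely_integrable (fun x => \int[m]_y K (x, y)).
Proof.
move=> m1; rewrite EFin_Rintegral_section1.
exact/integrable_fubini_F/bounded_integrable_prod.
Qed.

Lemma Rintegral_fubini (m1 : {finite_measure set T1 -> \bar R})
    (m2 : {finite_measure set T2 -> \bar R}) :
  \int[m1]_x \int[m2]_y K (x, y) = \int[m2]_y \int[m1]_x K (x, y).
Proof.
congr fine.
rewrite -[LHS]/(\int[m1]_x (EFin \o (fun x => (\int[m2]_y K (x, y))%R)) x)%E.
rewrite -[RHS]/(\int[m2]_y (EFin \o (fun y => (\int[m1]_x K (x, y))%R)) y)%E.
rewrite EFin_Rintegral_section1 EFin_Rintegral_section2.
exact/Fubini/bounded_integrable_prod.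
Qed.

Lemma finitely_integrable_charge_integral1 (nu : {charge set T2 -> \bar R}) :
  finitely_integrable (fun x => charge_integral nu (fun y => K (x, y))).
Proof.
by apply: finitely_integrableB; exact: finitely_integrable_Rintegral1.
Qed.

End fubini.

Section charge_fubini.
Context d1 d2 (T1 : measurableType d1) (T2 : measurableType d2) (R : realType).
Variable K : T1 * T2 -> R.
Hypothesis mK : measurable_fun setT K.
Hypothesis bK : [bounded K z | z in [set: T1 * T2]].

(** The two variables play the same role: this is
    finitely_integrable_Rintegral1 for the transposed kernel. *)
Lemma finitely_integrable_Rintegral2 (m : {finite_measure set T1 -> \bar R}) :
  finitely_integrable (fun y => \int[m]_x K (x, y)).
Proof.
apply: (@finitely_integrable_Rintegral1 _ _ _ _ _ (fun z => K (z.2, z.1))).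
  by apply: measurableT_comp => //; exact: measurable_fun_pair.
by have [M [Mreal KM]] := bK; exists M; split => // N MN [y x] _; exact: KM.
Qed.

(** The exchange for p1 - n1 and p2 - n2: both sides expand into the same four
    double integrals. *)
Lemma Rintegral_diff_fubini (p1 n1 : {finite_measure set T1 -> \bar R})
    (p2 n2 : {finite_measure set T2 -> \bar R}) :
  \int[p1]_x (\int[p2]_y K (x, y) - \int[n2]_y K (x, y)) -
  \int[n1]_x (\int[p2]_y K (x, y) - \int[n2]_y K (x, y)) =
  \int[p2]_y (\int[p1]_x K (x, y) - \int[n1]_x K (x, y)) -
  \int[n2]_y (\int[p1]_x K (x, y) - \int[n1]_x K (x, y)).
Proof.
have int1 m2 := finitely_integrable_Rintegral1 mK bK m2.
have int2 m1 := finitely_integrable_Rintegral2 m1.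
have fub m1 m2 := Rintegral_fubini mK bK m1 m2.
rewrite (RintegralB measurableT (int1 p2 p1) (int1 n2 p1)).
rewrite (RintegralB measurableT (int1 p2 n1) (int1 n2 n1)).
rewrite (RintegralB measurableT (int2 p1 p2) (int2 n1 p2)).
rewrite (RintegralB measurableT (int2 p1 n2) (int2 n1 n2)).
rewrite !fub; lra.
Qed.

Lemma charge_fubini (nu1 : {charge set T1 -> \bar R})
    (nu2 : {charge set T2 -> \bar R}) :
  charge_integral nu1 (fun x => charge_integral nu2 (fun y => K (x, y))) =
  charge_integral nu2 (fun y => charge_integral nu1 (fun x => K (x, y))).
Proof. exact: Rintegral_diff_fubini. Qed.

End charge_fubini.

(** * Countable unions *)

Section countable_unions.
Context d (T : measurableType d) (R : realType).

Lemma countable_bigcup_measurable (D : set (set T)) :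
  countable D -> D `<=` measurable -> measurable (\bigcup_(A in D) A).
Proof.
move=> /pfcard_geP[->|[f]] mD; first by rewrite bigcup_set0.
rewrite -(image_eq f) bigcup_image; apply: bigcupT_measurable => n.
have fDn : range f (f n) by exists n.
by apply: mD; rewrite image_eq in fDn.
Qed.

Lemma countable_bigcup_null (mu : {measure set T -> \bar R})
    (D : set (set T)) :
  countable D -> (forall A, D A -> measurable A /\ mu A = 0%E) ->
  mu (\bigcup_(A in D) A) = 0%E.
Proof.
move=> /[dup] cD /pfcard_geP[->|[f]] D0; first by rewrite bigcup_set0 measure0.
apply/negligibleP; first by apply: countable_bigcup_measurable => // A /D0[].
rewrite -(image_eq f) bigcup_image; apply: negligible_bigcup => n.
have fDn : range f (f n) by exists n.
rewrite image_eq in fDn; have [mfn fn0] := D0 _ fDn.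
exact/negligibleP.
Qed.

End countable_unions.

(** * Borel sets of a compact metric space *)

Section borel.
Context (R : realType) (d : measure_display) (Omega : borelMetricType R d).
Implicit Types (nu : {charge set Omega -> \bar R}).

Lemma open_borel_measurable (U : set Omega) : open U -> measurable U.
Proof. by move=> oU; rewrite borel_measurableE; exact: sub_sigma_algebra. Qed.

Hypothesis cptOmega : compact [set: Omega].

(** The product sigma-algebra is generated by boxes, and second countability makes
    every open set a countable union of open boxes. *)
Lemma open_prod_measurable (W : set (Omega * Omega)) :
  open W -> measurable (W : set (Omega * Omega)%type).
Proof.
move=> oW; have [B cB [oB nB]] := compact_second_countable cptOmega.
pose D := [set U.1 `*` U.2 | U in B `*` B] `&` [set A | A `<=` W].
suff -> : W = \bigcup_(A in D) A.
  apply: countable_bigcup_measurable.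
    apply: card_le_trans (subset_card_le (@subIsetl _ _ _)) _.
    apply: (card_le_trans (card_image_le _ _)); exact: countableX.
  move=> _ [[U [/= /oB oU1 /oB oU2] <-] _].
  by apply: measurableX; exact: open_borel_measurable.
apply/seteqP; split => [[x y] Wxy|z [A [_ AW] /AW //]].
have [[P Q]/= [Px Qy] PQW] : nbhs (x, y) W by exact: open_nbhs_nbhs.
have [U [BU Ux] UP] := nB x _ Px.
have [V [BV Vy] VQ] := nB y _ Qy.
exists (U `*` V) => //; split; first by exists (U, V).
by move=> [a b] [/UP Pa /VQ Qb]; exact: PQW.
Qed.

Lemma continuous_prod_measurable (K : Omega * Omega -> R) :
  continuous K -> measurable_fun setT K.
Proof.
move=> /continuousP cK; apply: (measurability _ (RGenOpens.measurableE R)).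
move=> _ [_ [a [b ->] <-]]; rewrite setTI; apply: open_prod_measurable.
exact/cK/interval_open.
Qed.

Lemma continuous_prod_bounded (K : Omega * Omega -> R) :
  continuous K -> [bounded K z | z in [set: Omega * Omega]].
Proof.
move=> cK; have : compact (K @` setT).
  apply: continuous_compact; first exact: continuous_subspaceT.
  by rewrite -setXTT; exact: compact_setX.
move=> /compact_bounded[M [Mreal KM]]; exists M; split => // N MN z _.
by apply: KM MN _ _; exists z.
Qed.

(** A point outside the support has a null open neighbourhood, hence lies in a null
    member of a countable basis; these members cover the complement. *)
Lemma charge_suppC_null nu :
  measurable (~` charge_supp nu) /\
  Defs.total_variation nu (~` charge_supp nu) = 0%E.
Proof.
have [B cB [oB nB]] := compact_second_countable cptOmega.
pose D := B `&` [set A | Defs.total_variation nu A = 0%E].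
have cD : countable D.
  exact: card_le_trans (subset_card_le (@subIsetl _ _ _)) cB.
have suppE : ~` charge_supp nu = \bigcup_(A in D) A.
  apply/seteqP; split => [x /=|x [A [BA A0] Ax] /(_ A (oB _ BA) Ax)]; last first.
    by rewrite A0 ltxx.
  move=> /existsNP[U /not_implyP[oU /not_implyP[Ux /negP]]].
  rewrite -leNgt => U0.
  have [A [BA Ax] AU] := nB x U (open_nbhs_nbhs (conj oU Ux)).
  exists A => //; split => //=; apply/eqP; rewrite eq_le measure_ge0 andbT.
  apply: le_trans U0; apply: le_measure => //;
    rewrite inE; apply: open_borel_measurable => //; exact: oB.
rewrite suppE; split.
  by apply: countable_bigcup_measurable => // A [/oB /open_borel_measurable].
apply: (@countable_bigcup_null _ _ _ (charge_variation (hahnP nu))) => // A.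
by move=> [/oB /open_borel_measurable mA A0].
Qed.

End borel.

(** * Energies and potentials *)

Section energy.
Context (R : realType) (d : measure_display) (Omega : borelMetricType R d).
Variable K : Omega * Omega -> R.
Hypothesis mK : measurable_fun setT K.
Hypothesis bK : [bounded K z | z in [set: Omega * Omega]].
Hypothesis symK : forall x y, K (x, y) = K (y, x).
Implicit Types nu mu : {charge set Omega -> \bar R}.

(** The energy integrates over the first variable of K and the potential over the
    second; the symmetry of K reconciles the two. *)
Lemma energy_potential nu : energy K nu = charge_integral nu (potential K nu).
Proof.
congr charge_integral; apply/funext => y.
by congr charge_integral; apply/funext => x.
Qed.

Lemma potential_finitely_integrable nu : finitely_integrable (potential K nu).
Proof. exact: finitely_integrable_charge_integral1. Qed.

Lemma potential_sub nu mu : potential K (charge_sub nu mu) =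
  fun x => potential K nu x - potential K mu x.
Proof.
apply/funext => x; apply: charge_integral_sub.
exact: section1_finitely_integrable.
Qed.

Lemma potential_reciprocity nu mu :
  charge_integral nu (potential K mu) = charge_integral mu (potential K nu).
Proof.
rewrite /potential charge_fubini//.
by congr charge_integral; apply/funext => y; congr charge_integral; apply/funext.
Qed.

(** The excess int U^mu dnu - I(mu), whose sign decides the comparison of
    I(nu - mu) with I(nu) - I(mu). *)
Lemma energy_sub nu mu : energy K (charge_sub nu mu) =
  energy K nu - energy K mu -
  2 * (charge_integral nu (potential K mu) - energy K mu).
Proof.
have intp := potential_finitely_integrable.
rewrite energy_potential potential_sub charge_integral_sub; last first.
  exact: finitely_integrableB.
rewrite !(@charge_integralB _ _ _ _ (potential K nu) (potential K mu))//.
rewrite (potential_reciprocity mu nu) -!energy_potential; lra.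
Qed.

End energy.

Unset Implicit Arguments.

Theorem lemma3p3 (R : realType) (d : measure_display)
    (Omega : borelMetricType R d) (cptOmega : compact [set: Omega])
    (K : Omega * Omega -> R) (kerK : kernel_on K) :
  (forall mu : probability Omega R,
    K_invariant K (prob_charge mu) ->
    forall nu : {charge set Omega -> \bar R},
      signed_probability nu ->
      energy K (charge_sub nu (prob_charge mu)) =
        energy K nu - energy K (prob_charge mu))
  /\
  (forall mu : probability Omega R,
    (forall x, energy K (prob_charge mu) <= potential K (prob_charge mu) x) ->
    (forall x, charge_supp (prob_charge mu) x ->
      potential K (prob_charge mu) x = energy K (prob_charge mu)) ->
    (forall nu : probability Omega R,
      energy K (charge_sub (prob_charge nu) (prob_charge mu)) <=
        energy K (prob_charge nu) - energy K (prob_charge mu))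
    /\
    (forall nu : {charge set Omega -> \bar R},
      signed_probability nu ->
      charge_supp nu `<=` charge_supp (prob_charge mu) ->
      energy K (charge_sub nu (prob_charge mu)) =
        energy K nu - energy K (prob_charge mu))).
Proof.
have [cK symK] := kerK.
have mK := continuous_prod_measurable cptOmega cK.
have bK := continuous_prod_bounded cptOmega cK.
have intp := potential_finitely_integrable mK bK.
have energy_subE (mu nu : {charge set Omega -> \bar R}) :
    charge_integral nu (potential K mu) = energy K mu ->
    energy K (charge_sub nu mu) = energy K nu - energy K mu.
  by move=> numu; rewrite energy_sub// numu subrr mulr0 subr0.
have int_cst (nu : {charge set Omega -> \bar R}) c : nu setT = 1%E ->
    charge_integral nu (cst c) = c.
  by move=> nu1; rewrite charge_integral_cst nu1 mulr1.
split => [mu invmu nu [_ nu1]|mu geK eqK].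
  apply: energy_subE; rewrite -[RHS](int_cst nu)//.
  by congr charge_integral; apply/funext => x; exact: invmu.
split => [nu|nu [_ nu1] supp_sub].
  rewrite energy_sub// gerDl oppr_le0 mulr_ge0// subr_ge0.
  have nu1 : prob_charge nu setT = 1%E by exact: probability_setT.
  rewrite -[leLHS](int_cst _ _ nu1).
  rewrite (charge_integral_measure nu (finitely_integrable_cst _)).
  rewrite (charge_integral_measure nu (intp _)).
  apply: le_Rintegral => //.
  - exact: finitely_integrable_cst.
  - exact: (intp _ nu).
apply: energy_subE; rewrite -[RHS](int_cst nu)//.
have [mS S0] := charge_suppC_null cptOmega nu.
apply: eq_charge_integral_null mS S0 _ _ _ => //.
  exact: finitely_integrable_measurable.
by move=> x /contrapT /supp_sub; exact: eqK.
Qed.
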